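(* Let $r\ge 0$ be a fixed integer and consider a random simplicial complex $Y\in\Omega_n^r$ with respect to the probability measure $\mathbb{P}_{r,\mathfrak p}$, where $\mathfrak p=(p_0,\dots,p_r)$, $p_i=n^{-\alpha_i}$, and $\alpha=\alpha(n)=(\alpha_0,\dots,\alpha_r)\in\mathbb{R}^{r+1}_+$ is a function of $n$. Assume that the limit $\alpha_\ast=\lim_{n\to\infty}\alpha(n)\in\mathbb{R}^{r+1}_+$ exists and that $\alpha_\ast\in\mathfrak{D}_k$ for some $k\in\{0,1,\dots,r\}$. Then: (1) There is a sequence $t=t(n)\to 0$ such that, a.a.s., $$(1-t)\cdot\frac{n^{\tau_k(\alpha)}}{(k+1)!}\ \le\ b_k(Y)\ \le\ (1+t)\cdot\frac{n^{\tau_k(\alpha)}}{(k+1)!}.$$ (2) For any $j\ne k$, a.a.s., $$b_j(Y)\ \le\ (1+o(1))\cdot (r+1)!\cdot n^{-e(\alpha)}\cdot b_k(Y),$$ where $$e(\alpha)=\min_{0\le s\le r}|1-\psi_s(\alpha)|.$$ (For $k<r$ and $n$ large, $e(\alpha)=\min\{1-\psi_k(\alpha),\ \psi_{k+1}(\alpha)-1\}$.)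
   Context: Model. Let $\Delta_n$ be the simplex with vertex set $\{1,\dots,n\}$, viewed as an abstract simplicial complex. For a subcomplex $Y\subset\Delta_n$, $f_i(Y)$ is the number of $i$-dimensional simplexes of $Y$, and $e_i(Y)$ is the number of $i$-dimensional external faces of $Y$, i.e. $i$-simplexes $\sigma\subset\Delta_n$ with $\sigma\not\subset Y$ but $\partial\sigma\subset Y$ (for $i=0$: vertices not in $Y$). $\Omega_n^r$ is the set of all subcomplexes $Y\subset\Delta_n$ with $\dim Y\le r$ (including the empty one). For $\mathfrak p=(p_0,\dots,p_r)$ with $0\le p_i\le 1$ the probability measure on $\Omega_n^r$ is $$\mathbb{P}_{r,\mathfrak p}(Y)=\prod_{i=0}^r p_i^{f_i(Y)}\cdot\prod_{i=0}^r(1-p_i)^{e_i(Y)},\qquad 0^0=1.$$ Notation. $\mathbb{R}_+=[0,\infty)$. For $\alpha=(\alpha_0,\dots,\alpha_r)$ and $k=0,\dots,r$ put $$\psi_k(\alpha)=\sum_{i=0}^r\binom{k}{i}\alpha_i,\qquad \tau_k(\alpha)=\sum_{i=0}^k[1-\psi_i(\alpha)],$$ with $\binom{k}{i}=0$ for $i>k$ and $\binom00=1$. Domains: $\mathfrak{D}_k=\{\alpha\in\mathbb{R}^{r+1}_+:\psi_k(\alpha)<1<\psi_{k+1}(\alpha)\}$ for $0\le k\le r-1$, and $\mathfrak{D}_r=\{\alpha\in\mathbb{R}^{r+1}_+:\psi_r(\alpha)<1\}$. If $\alpha_\ast\in\mathfrak{D}_k$, then $k$ is called the critical dimension of $Y$.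 $b_j(Y)=\dim_{\mathbb{Q}}H_j(Y;\mathbb{Q})$ is the $j$-th Betti number. ''A.a.s.'' means with probability tending to $1$ as $n\to\infty$. $o(1)$ denotes some deterministic sequence tending to $0$ as $n\to\infty$. *)

(* Defs.v *)
(* MathComp world, with MathComp-Analysis for the reals. *)
From HB Require Import structures.
From mathcomp Require Import all_boot all_order all_algebra.

Set Implicit Arguments.
Unset Strict Implicit.
Unset Printing Implicit Defensive.

Import Order.TTheory GRing.Theory Num.Theory.
Local Open Scope ring_scope.

Section Complexes.
Variable n : nat.
Implicit Types (Y : {set {set 'I_n}}) (s t : {set 'I_n}) (i j r : nat).

(* The vertices 1, ..., n are represented by 'I_n and a simplex by the nonempty
   set of its vertices; the empty set is never a simplex, so that the empty
   complex is set0. *)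
Definition is_complex Y : bool :=
  (set0 \notin Y) &&
  [forall s in Y, forall t : {set 'I_n}, (t != set0) && (t \subset s) ==> (t \in Y)].

(* A simplex of dimension i has i + 1 vertices. *)
Definition faces Y i : {set {set 'I_n}} := [set s in Y | #|s| == i.+1].

Definition external_faces Y i : {set {set 'I_n}} :=
  [set s : {set 'I_n} | [&& #|s| == i.+1, s \notin Y &
     [forall t : {set 'I_n}, (t != set0) && (t \proper s) ==> (t \in Y)]]].

(* Complexes of dimension at most r, including the empty one. *)
Definition Omega r : {set {set {set 'I_n}}} :=
  [set Y | is_complex Y & [forall s in Y, (#|s| <= r.+1)%N]].

Definition prob (R : numDomainType) r (p : 'I_r.+1 -> R) Y : R :=
  (\prod_(i < r.+1) p i ^+ #|faces Y i|) *
  (\prod_(i < r.+1) (1 - p i) ^+ #|external_faces Y i|).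

Definition prob_event (R : numDomainType) r (p : 'I_r.+1 -> R)
    (E : pred {set {set 'I_n}}) : R :=
  \sum_(Y in Omega r | E Y) prob p Y.

(* Rational chains of the full simplex in all degrees at once, each simplex
   being oriented by the natural order of its vertices. *)
Definition chain : vectType rat := {ffun {set 'I_n} -> rat^o}.

Definition simplex s : chain := [ffun t => (t == s)%:R].

(* The face opposite to x carries the sign (-1)^(position of x in s).  The
   condition excludes the empty face: homology is not reduced. *)
Definition simplex_boundary s : chain :=
  \sum_(x in s | s :\ x != set0)
     (-1) ^+ #|[set y in s | (y < x)%N]| *: simplex (s :\ x).

Definition boundary_fun (c : chain) : chain := \sum_s c s *: simplex_boundary s.

Lemma boundary_fun_is_linear : linear boundary_fun.
Proof.
move=> a c d; rewrite /boundary_fun scaler_sumr -big_split /=.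
by apply: eq_bigr => s _; rewrite !ffunE scalerDl scalerA.
Qed.

HB.instance Definition _ :=
  GRing.isLinear.Build rat chain chain *:%R boundary_fun boundary_fun_is_linear.

Definition boundary : 'End(chain) := linfun boundary_fun.

Definition chains Y j : {vspace chain} :=
  <<[seq simplex s | s <- enum (faces Y j)]>>%VS.

Definition cycles Y j : {vspace chain} := (chains Y j :&: lker boundary)%VS.

Definition boundaries Y j : {vspace chain} := (boundary @: chains Y j.+1)%VS.

Lemma boundary_simplex s : boundary (simplex s) = simplex_boundary s.
Proof.
rewrite lfunE /= /boundary_fun (bigD1 s) //= big1 => [|t tDs].
  by rewrite ffunE eqxx scale1r addr0.
by rewrite ffunE (negPf tDs) scale0r.
Qed.

Lemma boundary_sign s x y : x \in s -> y \in s -> x != y ->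
  (-1) ^+ #|[set z in s | (z < x)%N]| * (-1) ^+ #|[set z in s :\ x | (z < y)%N]| =
  - ((-1) ^+ #|[set z in s | (z < y)%N]| *
     (-1) ^+ #|[set z in s :\ y | (z < x)%N]|) :> rat.
Proof.
wlog lt_xy : x y / (x < y)%N => [IH xs ys xDy|xs ys _].
  have [lt_xy|lt_yx|/val_inj eq_xy] := ltngtP x y; first exact: IH.
    by rewrite (IH y x) ?opprK // eq_sym.
  by rewrite eq_xy eqxx in xDy.
have -> : [set z in s :\ y | (z < x)%N] = [set z in s | (z < x)%N].
  apply/setP=> z; rewrite !inE; case: (z =P y) => //= ->.
  by rewrite ltnNge (ltnW lt_xy) andbF.
have -> : [set z in s :\ x | (z < y)%N] = [set z in s | (z < y)%N] :\ x.
  by apply/setP=> z; rewrite !inE andbA.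
rewrite (cardsD1 x [set z in s | (z < y)%N]) inE xs lt_xy add1n exprS.
by rewrite mulN1r mulNr opprK mulrC.
Qed.

Lemma boundary_boundary (c : chain) : boundary (boundary c) = 0.
Proof.
have -> : boundary c = \sum_s c s *: simplex_boundary s by rewrite lfunE.
rewrite linear_sum big1 // => s _.
rewrite linearZ /= -[RHS](scaler0 _ (c s)); congr (_ *: _).
pose F (x y : 'I_n) : chain := ((-1) ^+ #|[set z in s | (z < x)%N]| *
  (-1) ^+ #|[set z in s :\ x | (z < y)%N]|) *: simplex (s :\ x :\ y).
pose P (x y : 'I_n) := [&& x \in s, y \in s, x != y & s :\ x :\ y != set0].
have -> : boundary (simplex_boundary s) = \sum_x \sum_(y | P x y) F x y.
  rewrite /simplex_boundary linear_sum big_mkcond; apply: eq_bigr => x _ /=.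
  case: ifP => [/andP[xs _]|xNs].
    rewrite linearZ /= boundary_simplex scaler_sumr.
    apply: eq_big => [y|y _]; last by rewrite scalerA.
    by rewrite /P !inE xs eq_sym -andbA /=; case: (x != y); rewrite ?andbF.
  rewrite big1 // => y /and4P[xs ys _ ne0]; case/negP: ne0.
  by move/negbT: xNs; rewrite xs negbK => /eqP ->; rewrite set0D.
set S := LHS; suff : S + S = 0.
  by rewrite -mulr2n => /eqP; rewrite -scaler_nat scaler_eq0 => /orP[|/eqP].
rewrite {2}/S (exchange_big_dep xpredT) //= -big_split big1 //= => x _.
rewrite [X in _ + X](eq_bigl (P x)) => [|y]; last first.
  by rewrite /P setDDl setUC -setDDl eq_sym; case: (x \in s); case: (y \in s).
rewrite -big_split big1 //= => y /and4P[xs ys xDy _].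
by rewrite /F boundary_sign // scaleNr [in X in _ + X]setDDl setUC -setDDl addNr.
Qed.

Lemma boundaries_sub_cycles Y j :
  is_complex Y -> (boundaries Y j <= cycles Y j)%VS.
Proof.
rewrite /boundaries /chains limg_span => /andP[_ /forall_inP cY].
apply/span_subvP => c /mapP[d /mapP[s]].
rewrite mem_enum inE => /andP[sY /eqP ss] -> ->.
rewrite memv_cap memv_ker boundary_boundary eqxx andbT boundary_simplex.
apply: memv_suml => x /andP[xs ne0]; apply/memvZ/memv_span/map_f.
rewrite mem_enum inE; move: ss; rewrite (cardsD1 x) xs add1n => -[->].
rewrite eqxx andbT.
by have /forallP/(_ (s :\ x)) := cY _ sY; rewrite ne0 subD1set.
Qed.

(* The dimension of H_j = cycles / boundaries with rational coefficients; by
   boundaries_sub_cycles the truncated subtraction is exact on complexes. *)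
Definition betti Y j : nat := (\dim (cycles Y j) - \dim (boundaries Y j))%N.

End Complexes.

From mathcomp Require Import all_classical all_reals all_analysis.
Import numFieldNormedType.Exports.
Local Open Scope classical_set_scope.

Section Exponents.
Variables (R : realType) (r : nat).
Implicit Types (a : 'rV[R]_r.+1) (k : nat).

Definition psi k a : R := \sum_(i < r.+1) 'C(k, i)%:R * a 0 i.

Definition tau k a : R := \sum_(i < k.+1) (1 - psi i a).

(* Used for k <= r only; for k = r the last condition is void. *)
Definition in_domain k a : Prop :=
  [/\ forall i, 0 <= a 0 i, psi k a < 1 & (k < r)%N -> 1 < psi k.+1 a].

(* The default value is the term of index 0, hence belongs to the range. *)
Definition gap a : R :=
  \big[Num.min/`|1 - psi 0 a|]_(s < r.+1) `|1 - psi s a|.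

End Exponents.

Definition pvec (R : realType) r n (a : 'rV[R]_r.+1) (i : 'I_r.+1) : R :=
  n%:R `^ (- a 0 i).

Definition aas (R : realType) r (alpha : nat -> 'rV[R]_r.+1)
    (E : forall n, pred {set {set 'I_n}}) : Prop :=
  (fun n => prob_event (pvec n (alpha n)) (E n)) @ \oo --> (1 : R).

(* Main.v *)
Require Import Defs.
From HB Require Import structures.
From mathcomp Require Import all_boot all_order all_algebra ring lra.

Set Implicit Arguments.
Unset Strict Implicit.
Unset Printing Implicit Defensive.

Import Order.TTheory GRing.Theory Num.Theory.
Local Open Scope ring_scope.

(** The measure on complexes is the law of the following random complex: select
    every simplex of dimension i <= r independently with probability p_i, and
    keep the simplexes all of whose faces are selected.  Hence a given complex A
    is contained in Y with probability the product of p_(dim s) over its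
    simplexes s ([prob_event_sub]), and the first two moments of the number
    f_j of j-simplexes of Y are explicit.

    Write T_m = sum_(s < m) (1 - psi_s), so that tau_j = T_(j+1).  The expected
    value of f_j is C(n, j+1) n^(T_(j+1) - (j+1)), about n^(tau_j) / (j+1)!.
    Two simplexes with m = j+1 vertices, l of which are common, are both in Y
    with a probability that exceeds the product of their probabilities by the
    factor n^(l - T_l), and a proportion of order n^(-l) of the pairs is of this
    kind.  So f_j is concentrated around its mean as soon as T_l is bounded below
    by a positive constant for 1 <= l <= j+1 ([face_count_concentration]).

    The function psi is nondecreasing in its index, so T increases by at least
    1 - psi_k at each step up to k+1 and then decreases by at least
    psi_(k+1) - 1.  Thus f_k is concentrated and f_(k-1), f_(k+1) are smaller by
    a power of n, and the inequality
    f_k - f_(k-1) - f_(k+1) <= b_k <= f_k gives the first claim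
    ([betti_critical]).

    For j <> k it remains to bound b_j <= f_j by about n^(tau_k - e)
    ([betti_off_critical]).  Here the bound on the expected value is not enough
    for |j - k| = 1, where the two powers of n may agree and Markov's inequality
    would lose a constant.  For j < k the number f_j is concentrated, and for
    j >= k+2 there is a power of n to spare.  The delicate case is j = k+1 when
    tau_(k+1) is close to 0: then f_j may have a Poisson limit and is not
    concentrated.  But in that case the expected number of pairs of
    (k+1)-simplexes with a common k-face, of order n^(2 tau_(k+1) - tau_k),
    tends to 0 ([prob_adjacent_pair]), and a complex without such pairs has no
    nonzero (k+1)-cycles ([betti_eq0]), so b_(k+1) = 0. *)

(** * The random complex as the core of independent simplexes *)

(** The probability that S is selected when every s is selected independently
    with probability q s. *)
Definition select_weight (R : comPzRingType) (T : finType) (q : T -> R)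
    (S : {set T}) : R :=
  \prod_s (if s \in S then q s else 1 - q s).

(** Replacing q s by 0 when s is a selected element of B, and 1 - q s by 0 when s
    is an unselected element of A, turns the left side into the expansion of a
    product of sums. *)
Lemma select_weight_between (R : comPzRingType) (T : finType) (q : T -> R)
    (A B : {set T}) : [disjoint A & B] ->
  \sum_(S : {set T} | (A \subset S) && [disjoint B & S]) select_weight q S =
  (\prod_(s in A) q s) * \prod_(s in B) (1 - q s).
Proof.
move=> dAB.
pose F s := if s \in B then 0 else q s.
pose G s := if s \in A then 0 else 1 - q s.
transitivity (\sum_(S in {set T}) \prod_s (if s \in S then F s else G s)).
  rewrite big_mkcond; apply: eq_bigr => S _; case: ifP => [/andP[sAS dBS]|].
    apply: eq_bigr => s _; rewrite /F /G; case: ifP => sS.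
      by case: ifP => // sB; rewrite (disjointFr dBS sB) in sS.
    by case: ifP => // sA; rewrite (subsetP sAS _ sA) in sS.
  move/negbT; rewrite negb_and => /orP[/subsetPn[s sA sNS]|].
    by rewrite (bigD1 s) //= (negPf sNS) /G sA mul0r.
  rewrite -setI_eq0 => /set0Pn[s /setIP[sB sS]].
  by rewrite (bigD1 s) //= sS /F sB mul0r.
rewrite -bigA_distr /= [X in X * _]big_mkcond [X in _ * X]big_mkcond -big_split.
apply: eq_bigr => s _ /=; rewrite /F /G.
case: (boolP (s \in A)) => sA; first by rewrite (disjointFr dAB sA) addr0 mulr1.
by case: ifP => _; rewrite ?add0r ?mul1r // addrC subrK.
Qed.

Section Core.
Variable n : nat.
Implicit Types (S Y A : {set {set 'I_n}}) (s t : {set 'I_n}).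

Definition face_set s : {set {set 'I_n}} :=
  [set t : {set 'I_n} | (t != set0) && (t \subset s)].

(** The largest complex contained in S. *)
Definition core S : {set {set 'I_n}} :=
  [set s : {set 'I_n} | (s != set0) && (face_set s \subset S)].

(** The external faces of all dimensions at once; when Y has dimension at most r
    there may also be some of dimension r + 1. *)
Definition minimal_nonfaces Y : {set {set 'I_n}} :=
  [set s : {set 'I_n} | [&& s != set0, s \notin Y & face_set s :\ s \subset Y]].

Lemma face_setS s t : s \subset t -> face_set s \subset face_set t.
Proof.
by move=> st; apply/subsetP => u; rewrite !inE => /andP[-> /subset_trans->].
Qed.

Lemma face_set_id s : s != set0 -> s \in face_set s.
Proof. by rewrite inE subxx andbT. Qed.

Lemma is_complexP Y : reflect
  ((set0 \notin Y) /\ forall s, s \in Y -> face_set s \subset Y) (is_complex Y).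
Proof.
apply: (iffP andP) => -[Y0 cY]; split => //.
  move=> s sY; apply/subsetP => t; rewrite inE => tP.
  by move/forall_inP: cY => /(_ s sY) /forallP/(_ t); rewrite tP.
apply/forall_inP => s sY; apply/forallP => t; apply/implyP => tP.
by apply: (subsetP (cY s sY)); rewrite inE.
Qed.

Lemma mem_complex Y s : is_complex Y -> s != set0 ->
  (s \in Y) = (face_set s \subset Y).
Proof.
move=> /is_complexP[_ cY] s0; apply/idP/idP => [/cY //|/subsetP -> //].
exact: face_set_id.
Qed.

Lemma face_set_complex s : is_complex (face_set s).
Proof.
apply/is_complexP; split=> [|t]; first by rewrite inE eqxx.
by rewrite inE => /andP[_ /face_setS].
Qed.

Lemma complexU A B : is_complex A -> is_complex B -> is_complex (A :|: B).
Proof.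
move=> /is_complexP[A0 cA] /is_complexP[B0 cB]; apply/is_complexP; split.
  by rewrite inE negb_or A0.
move=> s /setUP[/cA|/cB] sub; apply: subset_trans sub _;
  [exact: subsetUl | exact: subsetUr].
Qed.

Lemma core_sub S : core S \subset S.
Proof.
apply/subsetP => s; rewrite inE => /andP[s0 /subsetP]; apply.
exact: face_set_id.
Qed.

Lemma core_complex S : is_complex (core S).
Proof.
apply/is_complexP; split=> [|s]; first by rewrite inE eqxx.
rewrite inE => /andP[_ sS]; apply/subsetP => t; rewrite !inE => /andP[-> ts] /=.
exact: subset_trans (face_setS ts) sS.
Qed.

Lemma sub_core A S : is_complex A -> (A \subset core S) = (A \subset S).
Proof.
move=> /is_complexP[A0 cA]; apply/idP/idP => [|AS].
  by move/subset_trans; apply; apply: core_sub.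
apply/subsetP => s sA; rewrite inE (subset_trans (cA s sA) AS) andbT.
by apply: contra A0 => /eqP <-.
Qed.

(** If the core of S were larger than Y, a set in it of least size outside Y
    would be a minimal non-face of Y that belongs to S. *)
Lemma core_eq Y S : is_complex Y ->
  (core S == Y) = (Y \subset S) && [disjoint minimal_nonfaces Y & S].
Proof.
move=> cY; apply/eqP/andP => [<-|[YS dS]].
  rewrite core_sub; split=> //; rewrite -setI_eq0; apply/set0Pn => -[s].
  rewrite !inE => /andP[/and3P[s0 /negP sNcore sub] sS]; apply: sNcore.
  rewrite s0 -(setD1K (face_set_id s0)) subUset sub1set sS /=.
  exact: subset_trans sub (core_sub S).
apply/eqP; rewrite eqEsubset sub_core // YS andbT.
apply/subsetP => s sC; apply/negPn/negP => sNY.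
have ex : exists t : {set 'I_n}, (t \in core S) && (t \notin Y).
  by exists s; rewrite sC.
have [t /andP[tC tNY] tmin] : exists2 t : {set 'I_n},
    (t \in core S) && (t \notin Y) &
    forall u : {set 'I_n}, (u \in core S) && (u \notin Y) -> (#|t| <= #|u|)%N.
  case: ex => t0 t0P.
  case: (@arg_minnP _ t0 (fun t => (t \in core S) && (t \notin Y))
    (fun u => #|u|) t0P) => t.
  by exists t.
have /is_complexP[C0 cC] := core_complex S.
have t0 : t != set0 by apply: contra C0 => /eqP <-.
suff tM : t \in minimal_nonfaces Y.
  by have := disjointFr dS tM; rewrite (subsetP (core_sub S)).
rewrite inE t0 tNY; apply/subsetP => u /setD1P[uDt uF].
apply/negPn/negP => uNY.
have uC := subsetP (cC t tC) _ uF.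
have := tmin u; rewrite uC uNY => /(_ isT).
rewrite leqNgt => /negP; apply; apply: proper_card.
by move: uF; rewrite inE properEneq uDt => /andP[].
Qed.

End Core.

Section Law.
Variables (R : numDomainType) (n r : nat) (p : 'I_r.+1 -> R).
Implicit Types (S Y A : {set {set 'I_n}}) (s t : {set 'I_n}).

(** The value 0 outside the dimensions 0, ..., r makes the core belong to
    [Omega n r] with probability 1; the external faces of dimension r + 1 then contribute the
    factor 1. *)
Definition face_prob s : R :=
  if (0 < #|s| <= r.+1)%N then p (inord #|s|.-1) else 0.

Lemma prod_by_dim A (g : 'I_r.+1 -> R) :
  (forall s, s \in A -> 0 < #|s| <= r.+1)%N ->
  \prod_(s in A) g (inord #|s|.-1) = \prod_(i < r.+1) g i ^+ #|faces A i|.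
Proof.
move=> dimA.
rewrite (partition_big (fun s => inord #|s|.-1 : 'I_r.+1) xpredT) //=.
apply: eq_bigr => i _; rewrite -prodr_const.
apply: eq_big => [s|s /andP[_ /eqP->//]].
rewrite inE; case: (boolP (s \in A)) => //= /dimA /andP[s0 sr].
rewrite -val_eqE /= inordK ?prednK //.
by rewrite -[in RHS](prednK s0) eqSS.
Qed.

Lemma prob_prod Y : Y \in Omega n r ->
  prob p Y = (\prod_(s in Y) face_prob s) *
             \prod_(s in minimal_nonfaces Y) (1 - face_prob s).
Proof.
rewrite inE => /andP[/is_complexP[Y0 cY] /forall_inP dimY].
have dim0Y s : s \in Y -> (0 < #|s| <= r.+1)%N.
  move=> sY; rewrite dimY // card_gt0 andbT.
  by apply: contra Y0 => /eqP <-.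
congr (_ * _).
  rewrite -(prod_by_dim _ dim0Y); apply: eq_bigr => s sY.
  by rewrite /face_prob dim0Y.
rewrite [RHS](bigID (fun s : {set 'I_n} => (0 < #|s| <= r.+1)%N)) /=.
rewrite [X in _ = _ * X]big1 ?mulr1; last first.
  by move=> s /andP[_ /negPf sbig]; rewrite /face_prob sbig subr0.
pose M := [set s in minimal_nonfaces Y | (0 < #|s| <= r.+1)%N].
rewrite (eq_bigr (fun s : {set 'I_n} => 1 - p (inord #|s|.-1))); last first.
  by move=> s /andP[_ dims]; rewrite /face_prob dims.
rewrite (eq_bigl (fun s => s \in M)) => [|s]; last by rewrite !inE.
rewrite (@prod_by_dim M (fun i => 1 - p i)) => [|s]; last first.
  by rewrite inE => /andP[].
apply: eq_bigr => i _; congr (_ ^+ _); apply: eq_card => s.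
rewrite !inE; apply/and3P/andP => [[/eqP si sNY /forallP sub]|].
  rewrite -card_gt0 si eqxx /= ltn_ord andbT sNY; split=> //=.
  apply/subsetP => t /setD1P[tDs]; rewrite inE => /andP[t0 ts].
  by have := sub t; rewrite t0 properEneq tDs ts.
move=> [/andP[/and3P[s0 sNY /subsetP sub] sr] si].
split=> //; apply/forallP => t; apply/implyP => /andP[t0].
rewrite properEneq => /andP[tDs ts]; apply: sub.
by rewrite !inE tDs t0.
Qed.

(** The measure of the model is the law of the core of a random selection: the
    core is Y exactly when the simplexes of Y are selected and its minimal
    non-faces are not. *)
Lemma prob_core Y : Y \in Omega n r ->
  prob p Y = \sum_(S | core S == Y) select_weight face_prob S.
Proof.
move=> YO; rewrite prob_prod // -select_weight_between; last first.
  by rewrite -setI_eq0; apply/set0Pn => -[s]; rewrite !inE => /and4P[-> _ /negP].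
by apply: eq_bigl => S; rewrite core_eq //; move: YO; rewrite inE => /andP[].
Qed.

Lemma prob_event_core (E : pred {set {set 'I_n}}) :
  prob_event p E = \sum_(S | E (core S)) select_weight face_prob S.
Proof.
rewrite /prob_event (eq_bigr (fun Y =>
  \sum_(S | core S == Y) select_weight face_prob S)) => [|Y /andP[/prob_core]//].
rewrite (exchange_big_dep (fun S => (core S \in Omega n r) && E (core S))) /=;
  last by move=> Y S YP /eqP ->.
rewrite [RHS](bigID (fun S => core S \in Omega n r)) /=.
rewrite [X in _ = _ + X]big1 ?addr0 => [|S /andP[_]].
  apply: eq_big => [S|S SP]; first by rewrite andbC.
  rewrite (big_pred1 (core S)) // => Y /=; rewrite eq_sym.
  by case: eqP => [->|]; rewrite ?andbF ?SP.
rewrite inE core_complex /= => /forall_inPn[s sC].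
rewrite -ltnNge => big_s.
rewrite /select_weight (bigD1 s) //= (subsetP (core_sub S) _ sC).
by rewrite /face_prob [(_ <= r.+1)%N]leqNgt big_s andbF mul0r.
Qed.

(** A complex is contained in the core of S as soon as it is contained in S, so
    only the selection of its own simplexes matters. *)
Lemma prob_event_sub A : is_complex A ->
  prob_event p (fun Y => A \subset Y) = \prod_(s in A) face_prob s.
Proof.
move=> cA; rewrite prob_event_core.
have := @select_weight_between _ _ face_prob A set0.
rewrite big_set0 mulr1 => <-; last first.
  by rewrite -setI_eq0 setI0.
apply: eq_bigl => S; rewrite sub_core //.
by rewrite -setI_eq0 set0I eqxx andbT.
Qed.

Lemma prob_event_T : prob_event p (fun _ : {set {set 'I_n}} => true) = 1.
Proof.
have <- : \prod_(s in (set0 : {set {set 'I_n}})) face_prob s = 1 by rewrite big_set0.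
rewrite -prob_event_sub; first by apply: eq_bigl => Y; rewrite sub0set.
by apply/is_complexP; split=> [|s]; rewrite inE.
Qed.

End Law.

(** * Betti numbers, faces and cycles *)

Section Homology.
Variable n : nat.
Implicit Types (Y : {set {set 'I_n}}) (s t : {set 'I_n}).

Lemma span_simplex_support (l : seq {set 'I_n}) (c : chain n) t :
  c \in <<[seq simplex s | s <- l]>>%VS -> t \notin l -> c t = 0.
Proof.
move=> cl tl; rewrite (@coord_span _ _ _ (in_tuple _) _ cl) sum_ffunE big1 // => i _.
rewrite !ffunE; have il : (i < size l)%N by case: i => i; rewrite /= size_map.
rewrite (nth_map set0) // ffunE; case: eqP => [tE|]; last by rewrite scaler0.
by move: tl; rewrite tE mem_nth.
Qed.

Lemma dim_chains Y j : \dim (chains Y j) = #|faces Y j|.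
Proof.
rewrite /chains cardE; move: (enum_uniq (faces Y j)).
elim: (enum _) => [|s l IHl] /=; first by rewrite span_nil dimv0.
suff: forall l : seq {set 'I_n}, uniq l -> free [seq simplex s | s <- l].
  move=> fr /(fr (s :: l)); rewrite /free => /eqP -> /=.
  by rewrite size_map.
elim=> [|t l' IH] /=; first by rewrite nil_free.
move=> /andP[tl ul]; rewrite free_cons IH // andbT.
apply/negP => /span_simplex_support/(_ tl); rewrite ffunE eqxx => /eqP.
by rewrite oner_eq0.
Qed.

Lemma betti_le_faces Y j : (betti Y j <= #|faces Y j|)%N.
Proof.
by rewrite -dim_chains (leq_trans (leq_subr _ _)) // dimvS // capvSl.
Qed.

Lemma card_faces_above_dim r Y j : Y \in Omega n r -> (r < j)%N ->
  #|faces Y j| = 0%N.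
Proof.
rewrite inE => /andP[_ /forall_inP dimY] rj; apply/eqP; rewrite cards_eq0.
rewrite -subset0; apply/subsetP => s; rewrite !inE => /andP[/dimY sr /eqP sj].
by move: sr; rewrite sj ltnS leqNgt rj.
Qed.

Lemma dim_boundaries_le Y j : (\dim (boundaries Y j) <= #|faces Y j.+1|)%N.
Proof.
by rewrite -dim_chains -(limg_ker_dim (boundary n) (chains Y j.+1)) leq_addl.
Qed.

(** All 0-chains are cycles, since the empty face is not a simplex. *)
Lemma faces_le_betti0 Y :
  (#|faces Y 0| <= betti Y 0 + #|faces Y 1|)%N.
Proof.
suff cyc : (chains Y 0 <= cycles Y 0)%VS.
  by rewrite addnC -leq_subLR -dim_chains leq_sub ?dimvS ?dim_boundaries_le.
rewrite subv_cap subvv; apply/span_subvP => c /mapP[s].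
rewrite mem_enum inE => /andP[_ /cards1P[x ->]] ->.
rewrite memv_ker boundary_simplex /simplex_boundary big1 // => y.
by rewrite inE => /andP[/eqP ->]; rewrite setDv eqxx.
Qed.

(** By the rank theorem, the space of cycles has codimension at most
    [#|faces Y j|] in the space of chains. *)
Lemma faces_le_bettiS Y j : is_complex Y ->
  (#|faces Y j.+1| <= betti Y j.+1 + #|faces Y j| + #|faces Y j.+2|)%N.
Proof.
move=> cY; rewrite -{1}dim_chains -(limg_ker_dim (boundary n) (chains Y j.+1)).
have H1 : (\dim (boundary n @: chains Y j.+1) <= #|faces Y j|)%N.
  rewrite -dim_chains dimvS //.
  exact: subv_trans (boundaries_sub_cycles j cY) (capvSl _ _).
have H2 := dim_boundaries_le Y j.+1.
by rewrite /betti addnAC leq_add // addnC -leq_subLR leq_sub.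
Qed.

(** If s occurs in a cycle, the coefficient of a facet of s in the boundary can
    only be cancelled by another simplex that contains this facet. *)
Lemma betti_eq0 Y d :
  (forall s t, s \in faces Y d.+1 -> t \in faces Y d.+1 -> s != t ->
     #|s :&: t| != d.+1) ->
  betti Y d.+1 = 0%N.
Proof.
move=> noadj; rewrite /betti; suff -> : cycles Y d.+1 = 0%VS by rewrite dimv0.
apply/eqP; rewrite -subv0; apply/subvP => c /memv_capP[cY].
rewrite memv_ker memv0 => /eqP bc0; apply/eqP/ffunP => s; rewrite [RHS]ffunE.
have supp u : u \notin faces Y d.+1 -> c u = 0.
  by move=> uY; apply: (span_simplex_support cY); rewrite mem_enum.
have [sY|/supp//] := boolP (s \in faces Y d.+1).
have card_faces u : u \in faces Y d.+1 -> #|u| = d.+2.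
  by rewrite inE => /andP[_ /eqP].
have /card_gt0P[x xs] : (0 < #|s|)%N by rewrite card_faces.
have cardx : #|s :\ x| = d.+1.
  by have := card_faces s sY; rewrite (cardsD1 x) xs => -[].
have nex : s :\ x != set0 by rewrite -card_gt0 cardx.
have : (boundary n c) (s :\ x) = 0 by rewrite bc0 ffunE.
rewrite lfunE /= /boundary_fun sum_ffunE (bigD1 s) //= big1 => [|u uDs].
  rewrite addr0 !ffunE sum_ffunE (bigD1 x) ?xs //= big1 => [|y /andP[/andP[ys _] yDx]].
    rewrite addr0 !ffunE eqxx => /eqP.
    rewrite scaler_eq0 => /orP[/eqP//|]; rewrite scaler_eq0 signr_eq0 /=.
    by rewrite oner_eq0.
  rewrite !ffunE; case: eqP => [eq_s|]; last by rewrite scaler0.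
  have : x \in s :\ y by rewrite !inE eq_sym yDx.
  by rewrite -eq_s !inE eqxx.
rewrite ffunE; have [uY|/supp->] := boolP (u \in faces Y d.+1); last first.
  by rewrite scale0r.
rewrite sum_ffunE big1 ?scaler0 // => y /andP[yu _].
rewrite !ffunE; case: eqP => [eq_s|]; last by rewrite scaler0.
have := noadj u s uY sY uDs; case/negP; rewrite eqn_leq; apply/andP; split.
  rewrite -ltnS -(card_faces u uY); apply: proper_card.
  rewrite properEneq subsetIl andbT; apply: contra uDs => /eqP uE.
  by rewrite eqEcard -uE subsetIr /= uE !card_faces.
rewrite -cardx; apply: subset_leq_card; rewrite subsetI subD1set andbT.
by rewrite eq_s subD1set.
Qed.

End Homology.

(** * Counting pairs of vertex sets by their intersection *)

Lemma leq_bin_exp n m : ('C(n, m) <= n ^ m)%N.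
Proof.
have := max_card [set f : {ffun 'I_m -> 'I_n} | injectiveb f].
rewrite card_inj_ffuns card_ffun !card_ord; apply: leq_trans.
by rewrite -bin_ffact leq_pmulr // fact_gt0.
Qed.

(** At most n ^ (m - #|u|) sets t have a given intersection u with s, and each
    of them contributes n ^ #|u|; there are 2 ^ #|s| sets u. *)
Lemma sum_exp_card_setI n m (s : {set 'I_n}) :
  (\sum_(t : {set 'I_n} | #|t| == m) n ^ #|s :&: t| <= 2 ^ #|s| * n ^ m)%N.
Proof.
rewrite (partition_big (fun t => s :&: t) (fun u => u \in powerset s)) /=; last first.
  by move=> t _; rewrite inE subsetIl.
rewrite -card_powerset -sum_nat_const; apply: leq_sum => u.
rewrite inE => us; have [um|mu] := leqP #|u| m; last first.
  rewrite big1 // => t /andP[/eqP tm /eqP tu].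
  have: (#|s :&: t| <= #|t|)%N by rewrite subset_leq_card ?subsetIr.
  by rewrite tu tm leqNgt mu.
rewrite (eq_bigr (fun=> n ^ #|u|)%N) => [|t /andP[_ /eqP->]//].
rewrite sum_nat_const -[in leqRHS](subnK um) expnD leq_mul2r; apply/orP; right.
apply: leq_trans (leq_bin_exp _ _); rewrite -[n in 'C(n, _)]card_ord -card_draws.
pose D := [set t : {set 'I_n} | (#|t| == m) && (s :&: t == u)].
have -> : #|[pred t : {set 'I_n} | (#|t| == m) && (s :&: t == u)]| = #|D|.
  by apply: eq_card => t; rewrite !inE.
have Dinj : {in D &, injective (fun t => t :\: u)}.
  move=> t1 t2; rewrite !inE => /andP[_ /eqP u1] /andP[_ /eqP u2] e12.
  have ut1 : t1 :&: u = u by apply/setIidPr; rewrite -u1 subsetIr.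
  have ut2 : t2 :&: u = u by apply/setIidPr; rewrite -u2 subsetIr.
  by rewrite -(setID t1 u) -(setID t2 u) e12 ut1 ut2.
rewrite -(card_in_imset Dinj).
apply: subset_leq_card; apply/subsetP => v /imsetP[t].
rewrite !inE => /andP[/eqP tm /eqP tu] ->.
have ut : u \subset t by rewrite -tu subsetIr.
by rewrite cardsD (setIidPr ut) tm.
Qed.

(** * First and second moments of the numbers of faces *)

Section Moments.
Variables (R : realFieldType) (n r : nat) (p : 'I_r.+1 -> R).
Hypothesis p01 : forall i, 0 < p i <= 1.
Implicit Types (Y : {set {set 'I_n}}) (s t : {set 'I_n}).
Implicit Types (E : pred {set {set 'I_n}}) (X : {set {set 'I_n}} -> R).

Definition mean X : R := \sum_(Y in Omega n r) prob p Y * X Y.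

Lemma prob_ge0 Y : 0 <= prob p Y.
Proof.
rewrite /prob mulr_ge0 // prodr_ge0 // => i _; rewrite exprn_ge0 //;
  by have /andP[p0 p1] := p01 i; rewrite ?subr_ge0 // ltW.
Qed.

Lemma mean_event E : mean (fun Y => (E Y)%:R) = prob_event p E.
Proof.
rewrite /prob_event big_mkcondr /=; apply: eq_bigr => Y _.
by case: (E Y); rewrite ?mulr1 ?mulr0.
Qed.

Lemma mean_sum (I : finType) (P : pred I) (X : I -> {set {set 'I_n}} -> R) :
  mean (fun Y => \sum_(i | P i) X i Y) = \sum_(i | P i) mean (X i).
Proof. by rewrite exchange_big; apply: eq_bigr => Y _; rewrite mulr_sumr. Qed.

Lemma le_mean X1 X2 : (forall Y, Y \in Omega n r -> X1 Y <= X2 Y) ->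
  mean X1 <= mean X2.
Proof.
by move=> le12; apply: ler_sum => Y YO; rewrite ler_wpM2l ?prob_ge0 ?le12.
Qed.

Lemma le_prob_event E1 E2 : (forall Y, Y \in Omega n r -> E1 Y -> E2 Y) ->
  prob_event p E1 <= prob_event p E2.
Proof.
move=> sub; rewrite -!mean_event; apply: le_mean => Y YO.
by rewrite ler_nat; have := sub Y YO; case: (E1 Y) => // ->.
Qed.

Lemma prob_event_le1 E : prob_event p E <= 1.
Proof. by rewrite -(prob_event_T n p); apply: le_prob_event. Qed.

Lemma prob_event_neg E : prob_event p E = 1 - prob_event p (fun Y => ~~ E Y).
Proof.
apply/(canRL (addrK _)); rewrite -(prob_event_T n p) -!mean_event -big_split.
by apply: eq_bigr => Y _ /=; rewrite -mulrDr -natrD; case: (E Y).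
Qed.

Lemma prob_event_or E1 E2 : prob_event p (fun Y => E1 Y || E2 Y) <=
  prob_event p E1 + prob_event p E2.
Proof.
rewrite -!mean_event /mean -big_split; apply: ler_sum => Y _ /=.
rewrite -mulrDr ler_wpM2l ?prob_ge0 // -natrD ler_nat.
by case: (E1 Y); case: (E2 Y).
Qed.

Lemma markov X a : (forall Y, 0 <= X Y) -> 0 < a ->
  prob_event p (fun Y => a <= X Y) <= mean X / a.
Proof.
move=> X0 a0; rewrite ler_pdivlMr // -mean_event mulr_suml.
apply: ler_sum => Y _; rewrite -mulrA ler_wpM2l ?prob_ge0 //.
by case: (boolP (a <= X Y)) => aX; rewrite ?mul1r ?mul0r.
Qed.

Lemma chebyshev X a : 0 < a ->
  prob_event p (fun Y => a <= `|X Y - mean X|) <=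
  (mean (fun Y => X Y ^+ 2) - mean X ^+ 2) / a ^+ 2.
Proof.
move=> a0; set mu := mean X.
have -> : mean (fun Y => X Y ^+ 2) - mu ^+ 2 =
          mean (fun Y => (X Y - mu) ^+ 2).
  rewrite [RHS](eq_bigr (fun Y => prob p Y * X Y ^+ 2
    - mu * 2 * (prob p Y * X Y) + mu ^+ 2 * prob p Y)); last by move=> Y _; ring.
  rewrite big_split sumrB /= -!mulr_sumr.
  have -> : \sum_(Y in Omega n r) prob p Y = 1.
    by rewrite -(prob_event_T n p); apply: eq_bigl => Y; rewrite andbT.
  by rewrite -/(mean X) -/mu -/(mean (fun Y => X Y ^+ 2)); ring.
apply: le_trans (markov _ _); last exact: exprn_gt0.
  apply: le_prob_event => Y _ le_a.
  by rewrite -[leRHS]real_normK ?num_real // ler_pXn2r ?nnegrE // ltW.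
by move=> Y; apply: sqr_ge0.
Qed.

(** The probability that a given simplex with m vertices belongs to Y; it has
    C(m, i + 1) faces of dimension i. *)
Definition simplex_prob m : R := \prod_(i < r.+1) p i ^+ 'C(m, i.+1).

Lemma simplex_prob_gt0 m : 0 < simplex_prob m.
Proof. by apply: prodr_gt0 => i _; apply: exprn_gt0; case/andP: (p01 i). Qed.

Lemma simplex_prob0 : simplex_prob 0 = 1.
Proof. by apply: big1 => i _; rewrite bin0n expr0. Qed.

Lemma prod_face_set s : (#|s| <= r.+1)%N ->
  \prod_(t in face_set s) face_prob p t = simplex_prob #|s|.
Proof.
move=> sr; have dimF t : t \in face_set s -> (0 < #|t| <= r.+1)%N.
  rewrite inE card_gt0 => /andP[-> /subset_leq_card ts] /=.
  exact: leq_trans ts sr.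
transitivity (\prod_(t in face_set s) p (inord #|t|.-1)).
  by apply: eq_bigr => t /dimF dimt; rewrite /face_prob dimt.
rewrite prod_by_dim //; apply: eq_bigr => i _; congr (_ ^+ _).
rewrite -cards_draws; apply: eq_card => t; rewrite !inE.
by case: (t =P set0) => [->|]; rewrite ?cards0 ?andbF //= andbC.
Qed.

Lemma prob_face s : s != set0 -> (#|s| <= r.+1)%N ->
  prob_event p (fun Y => s \in Y) = simplex_prob #|s|.
Proof.
move=> s0 sr; rewrite -prod_face_set // -prob_event_sub ?face_set_complex //.
apply: eq_bigl => Y; have [|//] := boolP (Y \in Omega n r).
by rewrite inE => /andP[cY _]; rewrite mem_complex.
Qed.

(** The simplexes that s and t have in common are the faces of their
    intersection. *)
Lemma prob_face_pair s t : s != set0 -> t != set0 ->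
  (#|s| <= r.+1)%N -> (#|t| <= r.+1)%N ->
  prob_event p (fun Y => (s \in Y) && (t \in Y)) =
  simplex_prob #|s| * simplex_prob #|t| / simplex_prob #|s :&: t|.
Proof.
move=> s0 t0 sr tr.
transitivity (prob_event p (fun Y => face_set s :|: face_set t \subset Y)).
  apply: eq_bigl => Y; have [|//] := boolP (Y \in Omega n r).
  by rewrite inE => /andP[cY _]; rewrite subUset !mem_complex.
rewrite prob_event_sub; last by apply: complexU; apply: face_set_complex.
apply/(canRL (mulfK _)); first by rewrite gt_eqF ?simplex_prob_gt0.
rewrite -!prod_face_set //; last first.
  by apply: leq_trans sr; rewrite subset_leq_card ?subsetIl.
rewrite [X in _ * X = _](eq_bigl (fun u => u \in face_set s :&: face_set t));
  last by move=> u; rewrite !inE subsetI; case: (u != set0).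
rewrite (big_setID (face_set s)) /= [X in _ = _ * X](big_setID (face_set s)) /=.
rewrite setUK setDUl setDv set0U -mulrA.
by rewrite [face_set t :&: _]setIC [X in _ * X]mulrC.
Qed.

Definition face_count j Y : R := #|faces Y j|%:R.

Lemma face_countE j Y :
  face_count j Y = \sum_(s : {set 'I_n} | #|s| == j.+1) (s \in Y)%:R.
Proof.
rewrite /face_count -sum1_card natr_sum big_mkcond [RHS]big_mkcond /=.
by apply: eq_bigr => s _; rewrite inE andbC; case: (_ == _); case: (s \in Y).
Qed.

Let simplexE j s : #|s| == j.+1 -> (s != set0) * (#|s| = j.+1).
Proof. by move=> /eqP sj; rewrite -card_gt0 sj. Qed.

Lemma mean_face_count j : (j <= r)%N ->
  mean (face_count j) = 'C(n, j.+1)%:R * simplex_prob j.+1.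
Proof.
move=> jr; transitivity (mean (fun Y =>
    \sum_(s : {set 'I_n} | #|s| == j.+1) (s \in Y)%:R)).
  by apply: eq_bigr => Y _; rewrite face_countE.
rewrite mean_sum (eq_bigr (fun=> simplex_prob j.+1)) => [|s /simplexE sj].
  by rewrite sumr_const -cardsE card_draws card_ord mulr_natl.
by rewrite mean_event prob_face ?sj.
Qed.

(** The relation P selects the pairs that are counted: all of them for the
    second moment, those with a common facet for the existence of cycles. *)
Lemma mean_face_pairs j (P : rel {set 'I_n}) : (j <= r)%N ->
  mean (fun Y => \sum_(s : {set 'I_n} | #|s| == j.+1)
     \sum_(t : {set 'I_n} | (#|t| == j.+1) && P s t)
     ((s \in Y) && (t \in Y))%:R) =
  \sum_(s : {set 'I_n} | #|s| == j.+1)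
     \sum_(t : {set 'I_n} | (#|t| == j.+1) && P s t)
     simplex_prob j.+1 ^+ 2 / simplex_prob #|s :&: t|.
Proof.
move=> jr; rewrite mean_sum; apply: eq_bigr => s /simplexE sj.
rewrite mean_sum; apply: eq_bigr => t /andP[/simplexE tj _].
by rewrite mean_event prob_face_pair ?sj ?tj.
Qed.

Lemma sum_pairs_le j :
  \sum_(s : {set 'I_n} | #|s| == j.+1) \sum_(t : {set 'I_n} | #|t| == j.+1)
    n%:R ^+ #|s :&: t| <= 2 ^+ j.+1 * n%:R ^+ j.+1 ^+ 2 :> R.
Proof.
apply: (@le_trans _ _ (\sum_(s : {set 'I_n} | #|s| == j.+1)
    (2 ^ j.+1 * n ^ j.+1)%:R)).
  apply: ler_sum => s /eqP sj; under eq_bigr do rewrite -natrX.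
  by rewrite -natr_sum ler_nat; have := sum_exp_card_setI j.+1 s; rewrite sj.
rewrite sumr_const -cardsE card_draws card_ord -mulrnA -!natrX -natrM ler_nat.
by rewrite -!mulnA leq_mul2l leq_mul2l leq_bin_exp !orbT.
Qed.

(** Up to the factor m`!, the expected number of simplexes with m vertices. *)
Definition simplex_weight m : R := n%:R ^+ m * simplex_prob m.

Hypothesis n_gt0 : (0 < n)%N.

Lemma simplex_weight_gt0 m : 0 < simplex_weight m.
Proof. by rewrite mulr_gt0 ?exprn_gt0 ?ltr0n ?simplex_prob_gt0. Qed.

(** Chebyshev's inequality.  With Q_l for [simplex_prob l], the covariance of
    the events that s and t are in Y is Q_m ^ 2 (1 / Q_l - 1), where
    l = #|s :&: t|.  It vanishes for l = 0 and is at most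
    Q_m ^ 2 * delta * n ^ l otherwise, which [sum_pairs_le] allows to sum. *)
Lemma face_count_concentration j (delta eps : R) : (j <= r)%N ->
  (forall l, (0 < l <= j.+1)%N -> 1 <= delta * simplex_weight l) ->
  0 < delta -> 0 < eps ->
  prob_event p (fun Y => eps * simplex_weight j.+1 <=
     `|face_count j Y - 'C(n, j.+1)%:R * simplex_prob j.+1|) <=
  2 ^+ j.+1 * delta / eps ^+ 2.
Proof.
move=> jr sup delta0 eps0; have W0 := simplex_weight_gt0 j.+1.
rewrite -mean_face_count //; apply: le_trans (chebyshev _ _) _.
  exact: mulr_gt0.
rewrite ler_pdivrMr; last by rewrite exprn_gt0 // mulr_gt0.
have -> : 2 ^+ j.+1 * delta / eps ^+ 2 * (eps * simplex_weight j.+1) ^+ 2 =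
  simplex_prob j.+1 ^+ 2 * delta * (2 ^+ j.+1 * n%:R ^+ j.+1 ^+ 2).
  by rewrite /simplex_weight; field; rewrite gt_eqF.
apply: (@le_trans _ _ (\sum_(s : {set 'I_n} | #|s| == j.+1)
    \sum_(t : {set 'I_n} | #|t| == j.+1)
    simplex_prob j.+1 ^+ 2 * delta * n%:R ^+ #|s :&: t|)); last first.
  under eq_bigr do rewrite -mulr_sumr; rewrite -mulr_sumr.
  by rewrite ler_wpM2l ?sum_pairs_le // mulr_ge0 ?sqr_ge0 // ltW.
have -> : mean (fun Y => face_count j Y ^+ 2) =
  \sum_(s : {set 'I_n} | #|s| == j.+1) \sum_(t : {set 'I_n} | #|t| == j.+1)
    simplex_prob j.+1 ^+ 2 / simplex_prob #|s :&: t|.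
  (* The condition true is appended so as to match the relation P. *)
  under [RHS]eq_bigr do under eq_bigl do rewrite -[_ == _]andbT.
  rewrite -(mean_face_pairs (fun _ _ => true)) //.
  apply: eq_bigr => Y _; congr (_ * _).
  rewrite face_countE expr2 mulr_suml; apply: eq_bigr => s _.
  rewrite mulr_sumr; apply: eq_big => [t|t _]; first by rewrite andbT.
  by rewrite -natrM mulnb.
have -> : mean (face_count j) ^+ 2 = \sum_(s : {set 'I_n} | #|s| == j.+1)
    \sum_(t : {set 'I_n} | #|t| == j.+1) simplex_prob j.+1 ^+ 2.
  rewrite mean_face_count // !sumr_const -cardsE card_draws card_ord.
  by rewrite -mulrnA -[RHS]mulr_natl natrM; ring.
rewrite -sumrB; apply: ler_sum => s /eqP sj.
rewrite -sumrB; apply: ler_sum => t _.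
have Q0 := simplex_prob_gt0 #|s :&: t|.
rewrite -[X in _ - X]mulr1 -mulrBr -mulrA ler_wpM2l ?sqr_ge0 //.
have [st0|stN0] := eqVneq #|s :&: t| 0%N.
  by rewrite st0 simplex_prob0 invr1 subrr mulr1 ltW.
apply: (@le_trans _ _ (simplex_prob #|s :&: t|)^-1); first by rewrite gerBl.
rewrite -[leLHS]mul1r ler_pdivrMr // -mulrA sup // lt0n stN0 /= -sj.
by rewrite subset_leq_card ?subsetIl.
Qed.

Lemma face_count_markov j (b : R) : (j <= r)%N -> 0 < b ->
  prob_event p (fun Y => b <= face_count j Y) <= simplex_weight j.+1 / b.
Proof.
move=> jr b0; apply: (le_trans (markov (fun Y => ler0n _ _) b0)).
rewrite ler_pM2r ?invr_gt0 // mean_face_count // ler_pM2r ?simplex_prob_gt0 //.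
by rewrite -natrX ler_nat leq_bin_exp.
Qed.

Definition adjacent_pair d Y :=
  [exists s in faces Y d.+1, exists t in faces Y d.+1, #|s :&: t| == d.+1].

(** The expected number of adjacent pairs: two simplexes with d + 2 vertices
    that share d + 1 of them span d + 3 vertices, and their common facet is counted
    only once in the probability. *)
Lemma prob_adjacent_pair d : (d < r)%N ->
  prob_event p (adjacent_pair d) <=
  2 ^+ d.+2 * simplex_weight d.+2 ^+ 2 / simplex_weight d.+1.
Proof.
move=> dr; have n0 : 0 < n%:R :> R by rewrite ltr0n.
have Q0 := simplex_prob_gt0 d.+1.
rewrite -mean_event; apply: (@le_trans _ _ (mean (fun Y =>
  \sum_(s : {set 'I_n} | #|s| == d.+2)
     \sum_(t : {set 'I_n} | (#|t| == d.+2) && (#|s :&: t| == d.+1))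
     ((s \in Y) && (t \in Y))%:R))).
  apply: le_mean => Y _; have [|] := boolP (adjacent_pair d Y); last first.
    by move=> _; do 2 (apply: sumr_ge0 => ? _).
  move=> /exists_inP[s]; rewrite inE => /andP[sY sd] /exists_inP[t].
  rewrite inE => /andP[tY td] st.
  rewrite (bigD1 s) //= (bigD1 t) ?td //= sY tY -addrA lerDl.
  by rewrite addr_ge0 //; do ?(apply: sumr_ge0 => ? _).
rewrite mean_face_pairs //.
apply: (@le_trans _ _ (\sum_(s : {set 'I_n} | #|s| == d.+2)
    \sum_(t : {set 'I_n} | #|t| == d.+2)
    simplex_prob d.+2 ^+ 2 / simplex_weight d.+1 * n%:R ^+ #|s :&: t|)).
  apply: ler_sum => s _; rewrite [leRHS](bigID (fun t => #|s :&: t| == d.+1)) /=.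
  rewrite -[leLHS]addr0 lerD //; last first.
    apply: sumr_ge0 => t _; rewrite mulr_ge0 ?exprn_ge0 ?ler0n // divr_ge0 //.
      by rewrite sqr_ge0.
    exact/ltW/simplex_weight_gt0.
  apply: ler_sum => t /andP[_ /eqP ->].
  rewrite /simplex_weight le_eqVlt; apply/orP; left; apply/eqP; field.
  by rewrite !gt_eqF ?exprn_gt0.
under eq_bigr do rewrite -mulr_sumr; rewrite -mulr_sumr.
have -> : 2 ^+ d.+2 * simplex_weight d.+2 ^+ 2 / simplex_weight d.+1 =
  simplex_prob d.+2 ^+ 2 / simplex_weight d.+1 * (2 ^+ d.+2 * n%:R ^+ d.+2 ^+ 2).
  by rewrite /simplex_weight; field; rewrite !gt_eqF ?exprn_gt0.
rewrite ler_wpM2l ?sum_pairs_le // divr_ge0 ?sqr_ge0 //.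
exact/ltW/simplex_weight_gt0.
Qed.

End Moments.

(** * Asymptotics of powers of n *)

From mathcomp Require Import all_classical all_reals all_analysis.

Import numFieldNormedType.Exports.
Local Open Scope classical_set_scope.
Local Open Scope ring_scope.

Lemma natr_powR_gt0 (R : realType) n (y : R) : (0 < n)%N -> 0 < n%:R `^ y.
Proof. by move=> n0; rewrite powR_gt0 ?ltr0n. Qed.

Lemma natr_powRD (R : realType) n (y z : R) : (0 < n)%N ->
  n%:R `^ y * n%:R `^ z = n%:R `^ (y + z).
Proof. by move=> n0; rewrite powRD // pnatr_eq0 -lt0n n0 implybT. Qed.

Lemma natr_powR_le (R : realType) n (y z : R) : (0 < n)%N -> y <= z ->
  n%:R `^ y <= n%:R `^ z.
Proof. by move=> n0; apply: ler_powR; rewrite ler1n. Qed.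

Lemma cvg_natr_powRN (R : realType) (c : R) : 0 < c ->
  (fun n : nat => n%:R `^ (- c)) @ \oo --> (0 : R).
Proof.
move=> c0; apply/cvgr0Pnorm_lt => e e0; near=> n.
have n0 : 0 < n%:R :> R by rewrite ltr0n; near: n; exact: nbhs_infty_gt.
rewrite ger0_norm ?powR_ge0 // powRN invf_plt ?posrE ?powR_gt0 //.
have -> : e^-1 = (e^-1 `^ c^-1) `^ c.
  by rewrite -powRrM mulVf ?gt_eqF // powRr1 // invr_ge0 ltW.
rewrite gt0_ltr_powR ?nnegrE ?powR_ge0 ?ler0n //.
by near: n; exact: nbhs_infty_gtr.
Unshelve. all: by end_near. Qed.

Lemma cvg_bin_ratio (R : realType) m :
  (fun n : nat => 'C(n, m)%:R * m`!%:R / n%:R ^+ m) @ \oo --> (1 : R).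
Proof.
have -> : (fun n : nat => 'C(n, m)%:R * m`!%:R / n%:R ^+ m) =
          (fun n => (n ^_ m)%:R / n%:R ^+ m) :> (nat -> R).
  by apply/funext => n; rewrite -natrM bin_ffact.
elim: m => [|m IHm].
  under eq_fun do rewrite ffactn0 expr0 divr1; exact: cvg_cst.
have -> : (fun n => (n ^_ m.+1)%:R / n%:R ^+ m.+1) =
  (fun n => (n ^_ m)%:R / n%:R ^+ m * ((n - m)%:R / n%:R)) :> (nat -> R).
  apply/funext => n; rewrite ffactnSr natrM exprSr invfM; ring.
rewrite -[X in _ --> X]mulr1; apply: cvgM => //.
apply: (@cvg_trans _ ((fun n : nat => 1 - m%:R * n%:R `^ (- 1) : R) @ \oo)).
  apply: near_eq_cvg; near=> n.
  have n0 : (0 < n)%N by near: n; exact: nbhs_infty_gt.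
  have mn : (m <= n)%N by near: n; exact: nbhs_infty_ge.
  by rewrite powR_inv1 // natrB // mulrBl divff // pnatr_eq0 -lt0n.
suff : (fun n : nat => 1 - m%:R * n%:R `^ (- 1) : R) @ \oo --> (1 - m%:R * 0 : R).
  by rewrite mulr0 subr0.
by apply: cvgB; [exact: cvg_cst | apply: cvgMl_tmp; exact: cvg_natr_powRN].
Unshelve. all: by end_near. Qed.

(** * Estimates for a fixed number of vertices *)

Section Exponents.
Variables (R : realType) (r : nat) (a : 'rV[R]_r.+1).
Hypothesis a_ge0 : forall i, 0 <= a 0 i.

(** This is tau with the index shifted by one, so that the argument is a number
    of vertices and the empty set of vertices has exponent 0. *)
Definition growth m : R := \sum_(s < m) (1 - psi s a).

Lemma growthS m : growth m.+1 = growth m + (1 - psi m a).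
Proof. by rewrite /growth big_ord_recr. Qed.

Lemma psi_le s t : (s <= t)%N -> psi s a <= psi t a.
Proof.
by move=> st; apply: ler_sum => i _; rewrite ler_wpM2r // ler_nat leq_bin2l.
Qed.

Lemma gap_le s : (s <= r)%N -> gap a <= `|1 - psi s a|.
Proof.
move=> sr; exact: (bigmin_le _ (Ordinal (sr : s < r.+1)%N)
  (fun s : 'I_r.+1 => `|1 - psi s a|)).
Qed.

Lemma pvec_bounds n : (0 < n)%N -> forall i, 0 < pvec n a i <= 1.
Proof.
move=> n0 i; rewrite /pvec powR_gt0 ?ltr0n //=.
by rewrite -[leRHS](powRr0 n%:R) ler_powR ?ler1n // oppr_le0.
Qed.

(** By Pascal's rule C(m + 1, i + 1) = C(m, i + 1) + C(m, i), adding a vertex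
    multiplies the weight by n * n ^ (- psi m) = n ^ (1 - psi m). *)
Lemma simplex_weightE n m : (0 < n)%N ->
  simplex_weight n (pvec n a) m = n%:R `^ growth m.
Proof.
move=> n0; have nN0 : n%:R != 0 :> R by rewrite pnatr_eq0; case: n n0.
rewrite /simplex_weight; elim: m => [|m IHm].
  by rewrite simplex_prob0 expr0 mulr1 /growth big_ord0 powRr0.
rewrite growthS powRD ?nN0 ?implybT // -IHm.
have -> : n%:R `^ (1 - psi m a) = n%:R * \prod_i pvec n a i ^+ 'C(m, i).
  rewrite powRD ?nN0 ?implybT // powRr1 ?ler0n //; congr (_ * _).
  rewrite /psi -sumrN (big_morph (fun y => n%:R `^ y) (id1 := 1) (op1 := *%R)).
  - by apply: eq_bigr => i _; rewrite /pvec -powR_mulrn ?powR_ge0 // -powRrM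
      -mulrN mulrC.
  - by move=> y z; rewrite powRD ?nN0 ?implybT.
  - by rewrite powRr0.
rewrite exprSr mulrACA; congr (_ * _).
rewrite /simplex_prob -big_split; apply: eq_bigr => i _ /=.
by rewrite -exprD binS addnC.
Qed.

(** A quantitative form of the condition that a lies in the k-th domain.  The
    factor 16 leaves room for all the losses of a few multiples of h in the
    exponents below. *)
Definition critical_margin k h : Prop :=
  [/\ 0 < h, 16 * h <= 1 - psi k a &
      (k < r)%N -> 16 * h <= psi k.+1 a - 1].

Section FixedSize.
Variable n : nat.
Hypothesis n_gt0 : (0 < n)%N.
Variable h : R.
Local Notation x := (n%:R : R).
Local Notation pr := (prob_event (pvec n a)).
Implicit Types (Y : {set {set 'I_n}}).

(** A common bound for the probabilities of the exceptional events.  Relative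
    deviations of size n ^ (- h) are tolerated, so that a relative variance of
    order n ^ (- 4h) gives n ^ (- 4h) / (n ^ (- h)) ^ 2 = n ^ (- 2h). *)
Definition error_bound : R := 2 ^+ r.+1 * x `^ (- (2 * h)).

Definition mean_faces j : R :=
  'C(n, j.+1)%:R / x ^+ j.+1 * x `^ growth j.+1.

Let p01 := pvec_bounds n_gt0.

Lemma mean_facesE j :
  'C(n, j.+1)%:R * simplex_prob (pvec n a) j.+1 = mean_faces j.
Proof.
have x0 : x ^+ j.+1 != 0 by rewrite expf_neq0 // pnatr_eq0 -lt0n.
by rewrite /mean_faces -simplex_weightE // /simplex_weight mulrA divfK.
Qed.

Lemma mean_faces_le j : mean_faces j <= x `^ growth j.+1.
Proof.
rewrite -[leRHS]mul1r ler_wpM2r ?powR_ge0 // ler_pdivrMr ?exprn_gt0 ?ltr0n //.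
by rewrite mul1r -natrX ler_nat leq_bin_exp.
Qed.

Lemma pow2_le_error m : (m <= r.+1)%N ->
  2 ^+ m * x `^ (- (2 * h)) <= error_bound.
Proof. by move=> mr; rewrite ler_wpM2r ?powR_ge0 // ler_weXn2l // ler1n. Qed.

Lemma pow_le_error y : y <= - (2 * h) -> x `^ y <= error_bound.
Proof.
move=> yh; apply: le_trans (pow2_le_error (leq0n _)).
by rewrite expr0 mul1r natr_powR_le.
Qed.

Lemma faces_concentrated j : (j <= r)%N ->
  (forall l, (0 < l <= j.+1)%N -> 4 * h <= growth l) ->
  pr (fun Y => x `^ (- h) * x `^ growth j.+1 <=
               `|#|faces Y j|%:R - mean_faces j|) <= error_bound.
Proof.
move=> jr lb; rewrite -simplex_weightE // -mean_facesE.
apply: le_trans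
  (@face_count_concentration _ _ _ _ p01 n_gt0 _ (x `^ (- (4 * h))) _ jr _ _ _) _.
- move=> l lj; rewrite simplex_weightE // natr_powRD // -[leLHS](powRr0 x).
  by rewrite natr_powR_le // addrC subr_ge0 lb.
- exact: natr_powR_gt0.
- exact: natr_powR_gt0.
rewrite expr2 natr_powRD // -mulrA -powRN natr_powRD //.
apply: le_trans (pow2_le_error (jr : j.+1 <= r.+1)%N).
by rewrite le_eqVlt; apply/orP; left; apply/eqP; congr (_ * _ `^ _); ring.
Qed.

Lemma faces_le_concentrated j : (j <= r)%N ->
  (forall l, (0 < l <= j.+1)%N -> 4 * h <= growth l) ->
  pr (fun Y => (1 + x `^ (- h)) * x `^ growth j.+1 < #|faces Y j|%:R)
    <= error_bound.
Proof.
move=> jr lb; apply: le_trans (faces_concentrated jr lb).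
apply: le_prob_event => // Y _; rewrite mulrDl mul1r => big.
apply: le_trans (ler_norm _); rewrite lerBrDl.
by apply: le_trans (ltW big); rewrite lerD2r mean_faces_le.
Qed.

(** Markov's inequality: the mean is less than the threshold n ^ (y - h) by the
    factor n ^ (- 2h). *)
Lemma faces_rare j y : (j <= r)%N -> growth j.+1 <= y - 3 * h ->
  pr (fun Y => x `^ (- h) * x `^ y <= #|faces Y j|%:R) <= error_bound.
Proof.
move=> jr gy; rewrite natr_powRD //.
apply: le_trans (face_count_markov n p01 jr (natr_powR_gt0 _ n_gt0)) _.
rewrite simplex_weightE // -powRN natr_powRD //; apply: pow_le_error; lra.
Qed.

(** When simplexes of dimension d + 1 are too scarce to be adjacent, they carry
    no cycle. *)
Lemma betti_rare d : (d < r)%N ->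
  2 * growth d.+2 - growth d.+1 <= - (2 * h) ->
  pr (fun Y => betti Y d.+1 != 0%N) <= error_bound.
Proof.
move=> dr gy; apply: le_trans (_ : pr (adjacent_pair d) <= _).
  apply: le_prob_event => // Y _; apply: contraNT => noadj; apply/eqP.
  apply: betti_eq0 => s t sY tY sDt; apply: contra noadj => st.
  by apply/exists_inP; exists s => //; apply/exists_inP; exists t.
apply: le_trans (prob_adjacent_pair p01 n_gt0 dr) _.
rewrite !simplex_weightE // expr2 natr_powRD // -mulrA -powRN natr_powRD //.
apply: le_trans (pow2_le_error (dr : d.+2 <= r.+1)%N).
by rewrite ler_wpM2l ?exprn_ge0 // natr_powR_le //; lra.
Qed.

Variable k : nat.
Hypothesis k_le_r : (k <= r)%N.
Hypothesis crit : critical_margin k h.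

(** By monotonicity of psi, the values psi_k < 1 < psi_(k+1) are the closest to
    1 on either side. *)
Lemma gapE : (k < r)%N -> gap a = Num.min (1 - psi k a) (psi k.+1 a - 1).
Proof.
have [h_gt0 below above] := crit.
move=> kr; have ab := above kr; apply/eqP; rewrite eq_le; apply/andP; split.
  have k0 : 0 <= 1 - psi k a by lra.
  have k1 : 1 - psi k.+1 a <= 0 by lra.
  have := gap_le k_le_r; rewrite (ger0_norm k0) => gk.
  have := gap_le kr; rewrite (ler0_norm k1) => gk1.
  by rewrite le_min gk -[_ - 1]opprB.
have key s : Num.min (1 - psi k a) (psi k.+1 a - 1) <= `|1 - psi s a|.
  rewrite ge_min; have [sk|ks] := leqP s k.
    by have psk := psi_le sk; apply/orP; left; apply: le_trans (ler_norm _); lra.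
  have psk := psi_le ks; apply/orP; right; rewrite distrC.
  by apply: le_trans (ler_norm _); lra.
by apply/bigmin_geP; split=> [|i _]; apply: key.
Qed.

Lemma gap_le_below : gap a <= 1 - psi k a.
Proof.
have [h_gt0 below above] := crit.
have k0 : 0 <= 1 - psi k a by lra.
by have := gap_le k_le_r; rewrite (ger0_norm k0).
Qed.

Lemma gap_le_above : (k < r)%N -> gap a <= psi k.+1 a - 1.
Proof. by move=> kr; rewrite gapE // ge_min lexx orbT. Qed.

Lemma growth_ge l : (0 < l <= k.+1)%N -> 16 * h <= growth l.
Proof.
have [h_gt0 below above] := crit.
case: l => // l /= lk; elim: l lk => [|l IHl] lk; rewrite growthS.
  by rewrite /growth big_ord0 add0r; have := psi_le (leq0n k); lra.
by have := IHl (ltnW lk); have := psi_le (lk : l.+1 <= k)%N; lra.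
Qed.

Lemma growth_incr l m : (l <= m <= k.+1)%N -> growth l <= growth m.
Proof.
have [h_gt0 below above] := crit.
case/andP; elim: m => [|m IHm]; first by rewrite leqn0 => /eqP ->.
rewrite leq_eqVlt => /orP[/eqP->//|lm] mk; apply: le_trans (IHm lm (ltnW mk)) _.
by rewrite growthS; have := psi_le (mk : m <= k)%N; lra.
Qed.

Lemma growth_decr l m : (k < r)%N -> (k.+1 <= l <= m)%N -> growth m <= growth l.
Proof.
have [h_gt0 below above] := crit.
move=> kr /andP[kl]; elim: m => [|m IHm]; first by rewrite leqn0 => /eqP ->.
rewrite leq_eqVlt => /orP[/eqP<-//|lm]; apply: le_trans (IHm lm).
rewrite growthS; have := psi_le (leq_trans kl (lm : l <= m)%N).
by have := above kr; lra.
Qed.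

Lemma faces_rare_near_k j : (j <= r)%N -> (j.+1 = k) \/ (j = k.+1) ->
  pr (fun Y => x `^ (- h) * x `^ growth k.+1 <= #|faces Y j|%:R) <= error_bound.
Proof.
have [h_gt0 below above] := crit.
move=> jr [jk|jk]; apply: faces_rare => //.
  by rewrite jk growthS; lra.
by rewrite jk [growth k.+2]growthS; have := above; rewrite -jk => /(_ jr); lra.
Qed.

(** The exponent of f_j is always at most that of the bound.  For j < k, and for
    j = k + 1 when the exponent tau_j is at least 4h, f_j is concentrated.  For
    j = k + 1 and tau_j < 4h, adjacent j-simplexes are improbable because
    2 tau_j - tau_k <= 8h - 16h.  For j >= k + 2 the exponent is smaller by
    psi_(k+2) - 1 >= 16h, so Markov's inequality suffices. *)
Lemma betti_off_critical j : j != k ->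
  pr (fun Y => (1 + x `^ (- h)) * x `^ (growth k.+1 - gap a) < (betti Y j)%:R)
    <= error_bound.
Proof.
have [h_gt0 below above] := crit.
move=> jDk; have pos : 0 <= 1 + x `^ (- h) by rewrite addr_ge0 ?powR_ge0.
have [jr|rj] := leqP j r; last first.
  rewrite /prob_event big1 ?mulr_ge0 ?exprn_ge0 ?powR_ge0 // => Y /andP[YO].
  have := betti_le_faces Y j; rewrite (card_faces_above_dim YO rj) leqn0.
  by move=> /eqP ->; rewrite ltNge mulr_ge0 ?powR_ge0.
have conc : growth j.+1 <= growth k.+1 - gap a ->
  (forall l, (0 < l <= j.+1)%N -> 4 * h <= growth l) ->
  pr (fun Y => (1 + x `^ (- h)) * x `^ (growth k.+1 - gap a) < (betti Y j)%:R)
    <= error_bound.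
  move=> gj lb; apply: le_trans (faces_le_concentrated jr lb).
  apply: le_prob_event => // Y _ big.
  apply: (@lt_le_trans _ _ (betti Y j)%:R); last by rewrite ler_nat betti_le_faces.
  by apply: le_lt_trans big; rewrite ler_wpM2l // natr_powR_le.
have [jk|kj|jk] := ltngtP j k; last by rewrite jk eqxx in jDk.
  apply: conc => [|l /andP[l0 lj]].
    apply: le_trans (growth_incr (_ : j.+1 <= k <= k.+1)%N) _.
      by rewrite jk /=.
    by rewrite [growth k.+1]growthS; have := gap_le_below; lra.
  have lk : (0 < l <= k.+1)%N by rewrite l0 (leq_trans lj) // leqW.
  by have := growth_ge lk; lra.
have kr : (k < r)%N := leq_trans kj jr.
have ab := above kr; have gab := gap_le_above kr.
have [jk1|jDk1] := eqVneq j k.+1.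
  have [large|small] := leP (4 * h) (growth k.+2).
    apply: conc => [|l /andP[l0]]; rewrite jk1.
      by rewrite [growth k.+2]growthS; lra.
    rewrite leq_eqVlt => /orP[/eqP -> //|lk].
    have lk' : (0 < l <= k.+1)%N by rewrite l0 -ltnS.
    by have := growth_ge lk'; lra.
  have gk : 16 * h <= growth k.+1 by apply: growth_ge; rewrite ltnS leqnn.
  apply: le_trans (betti_rare kr _); last by lra.
  apply: le_prob_event => // Y _; rewrite jk1; apply: contraTneq => ->.
  by rewrite -leNgt mulr_ge0 ?powR_ge0.
apply: le_trans (faces_rare (y := growth k.+1 - gap a) jr _).
  apply: le_prob_event => // Y _ big.
  apply: (@le_trans _ _ (betti Y j)%:R); last by rewrite ler_nat betti_le_faces.
  by apply: le_trans (ltW big); rewrite ler_wpM2r ?powR_ge0 // lerDr.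
apply: le_trans (growth_decr kr (_ : k.+1 <= k.+3 <= j.+1)%N) _.
  by rewrite ltnS leqW //= ltnS ltn_neqAle eq_sym jDk1.
rewrite [growth k.+3]growthS [growth k.+2]growthS.
by have := psi_le (leqnSn k.+1); lra.
Qed.

(** The first term accounts for f_(k-1), f_(k+1) and the fluctuation of f_k,
    each at most n ^ (- h) n ^ (tau_k); the second one for replacing C(n, k+1) by
    n ^ (k+1) / (k+1)!. *)
Definition relative_error : R :=
  3 * k.+1`!%:R * x `^ (- h) + (1 - 'C(n, k.+1)%:R * k.+1`!%:R / x ^+ k.+1).

(** Outside three exceptional events, f_k is close to its mean and f_(k-1),
    f_(k+1) are negligible, so that f_k - f_(k-1) - f_(k+1) <= b_k <= f_k
    determines b_k. *)
Lemma betti_critical :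
  pr (fun Y => ~~ ((1 - relative_error) * (x `^ growth k.+1 / k.+1`!%:R)
                   <= (betti Y k)%:R <=
                   (1 + relative_error) * (x `^ growth k.+1 / k.+1`!%:R)))
    <= 3 * error_bound.
Proof.
have [h_gt0 below above] := crit.
set u := x `^ (- h); set W := x `^ growth k.+1.
pose bad0 Y := u * W <= `|#|faces Y k|%:R - mean_faces k|.
(* The first conjuncts of bad1 and bad2 discard the dimensions -1 and r + 1,
   in which there are no faces. *)
pose bad1 Y := (0 < k)%N && (u * W <= #|faces Y k.-1|%:R).
pose bad2 Y := (k < r)%N && (u * W <= #|faces Y k.+1|%:R).
have err0 : 0 <= error_bound by rewrite mulr_ge0 ?exprn_ge0 ?powR_ge0.
have event0 (b : bool) (E : pred {set {set 'I_n}}) : (b -> pr E <= error_bound) ->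
    pr (fun Y => b && E Y) <= error_bound.
  case: b => /= [|_]; first exact.
  by rewrite /prob_event big1 // => Y; rewrite andbF.
have P0 : pr bad0 <= error_bound.
  apply: faces_concentrated => // l lk.
  by have := growth_ge lk; lra.
have P1 : pr bad1 <= error_bound.
  apply: event0 => k0; apply: faces_rare_near_k; last by left; rewrite prednK.
  exact: leq_trans (leq_pred _) k_le_r.
have P2 : pr bad2 <= error_bound.
  by apply: event0 => kr; apply: faces_rare_near_k; last by right.
apply: (@le_trans _ _ (pr (fun Y => bad0 Y || (bad1 Y || bad2 Y)))); last first.
  apply: le_trans (prob_event_or p01 _ _) _.
  have := prob_event_or p01 bad1 bad2.
  by move: P0 P1 P2; lra.
apply: le_prob_event => // Y YO; apply: contraNT.
rewrite !negb_or -ltNge => /and3P[good0 good1 good2].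
have cY : is_complex Y by move: YO; rewrite inE => /andP[].
have uW : 0 < u * W by rewrite mulr_gt0 // natr_powR_gt0.
have above_small : #|faces Y k.+1|%:R <= u * W.
  have [kr|rk] := ltnP k r.
    by move: good2; rewrite /bad2 kr /= -ltNge => /ltW.
  by rewrite (card_faces_above_dim YO) ?ltnS // ltW.
have lower : #|faces Y k|%:R <= (betti Y k)%:R + 2 * (u * W).
  have [k0|] := posnP k.
    have := faces_le_betti0 Y; move: above_small; rewrite k0.
    by rewrite -(ler_nat R) natrD; lra.
  move: good1; rewrite /bad1; case: (k) above_small => // k' small2 /=.
  rewrite -ltNge => small1 _.
  by have := faces_le_bettiS k' cY; rewrite -(ler_nat R) !natrD; lra.
have upper : (betti Y k)%:R <= #|faces Y k|%:R :> R.
  by rewrite ler_nat betti_le_faces.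
have f0 : 0 < k.+1`!%:R :> R by rewrite ltr0n fact_gt0.
have W0 : 0 < W by exact: natr_powR_gt0.
have xk0 : 0 < x ^+ k.+1 by rewrite exprn_gt0 ?ltr0n.
rewrite /relative_error -/u; set rho := 'C(n, k.+1)%:R * _ / _.
set F := k.+1`!%:R in f0 *.
have rho1 : rho <= 1.
  rewrite ler_pdivrMr // mul1r -natrM -natrX ler_nat bin_ffact.
  rewrite ffact_prod -[X in (_ <= _ ^ X)%N]card_ord -prod_nat_const.
  by apply: leq_prod => i _; apply: leq_subr.
pose M := W / F; have M0 : 0 < M by rewrite divr_gt0.
have WE : W = F * M by rewrite /M mulrC divfK ?gt_eqF.
have meanE : mean_faces k = rho * M.
  by rewrite /mean_faces /rho -/W /M; field; rewrite !gt_eqF.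
rewrite -/M; move: good0; rewrite meanE ltr_norml => /andP[].
have : 0 <= (1 - rho) * M by rewrite mulr_ge0 ?subr_ge0 // ltW.
have : 0 < u * (F * M) by rewrite -WE.
move: lower upper; rewrite WE.
set b := (betti Y k)%:R; set f := #|_|%:R; move=> lower upper ge0 pos up low.
by apply/andP; split; lra.
Qed.

End FixedSize.
End Exponents.

(** * Passage to the limit *)

Section Asymptotics.
Variables (R : realType) (r : nat) (alpha : nat -> 'rV[R]_r.+1).
Hypothesis alpha_ge0 : forall n i, 0 <= alpha n 0 i.

Lemma aas_of_bound (E : forall n, pred {set {set 'I_n}}) (v : nat -> R) :
  v @ \oo --> (0 : R) ->
  (\forall n \near \oo,
     prob_event (pvec n (alpha n)) (fun Y => ~~ E n Y) <= v n) ->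
  aas alpha E.
Proof.
move=> v0 bound; rewrite /aas.
apply: (@squeeze_cvgr _ _ _ _ (fun n => 1 - v n) (fun=> 1)); last exact: cvg_cst.
  near=> n; have n0 : (0 < n)%N by near: n; exact: nbhs_infty_gt.
  have p01 := pvec_bounds (alpha_ge0 n) n0.
  rewrite prob_event_le1 // andbT prob_event_neg lerD2l lerN2.
  by near: n.
suff : (fun n => 1 - v n) @ \oo --> (1 - 0 : R) by rewrite subr0.
by apply: cvgB; first exact: cvg_cst.
Unshelve. all: by end_near. Qed.

Variables (alpha_star : 'rV[R]_r.+1) (k : nat).
Hypothesis alpha_lim : alpha @ \oo --> alpha_star.

Lemma cvg_psi s : (fun n => psi s (alpha n)) @ \oo --> psi s alpha_star.
Proof.
apply: cvg_big => [|i _]; first exact: add_continuous.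
apply: cvgMl_tmp.
exact: (continuous_cvg _ (@coord_continuous R _ _ 0 i alpha_star) alpha_lim).
Qed.

Lemma near_critical_margin : in_domain k alpha_star ->
  exists h, \forall n \near \oo, critical_margin (alpha n) k h.
Proof.
move=> [_ below above].
pose g := if (k < r)%N then Num.min (1 - psi k alpha_star) (psi k.+1 alpha_star - 1)
          else 1 - psi k alpha_star.
have g0 : 0 < g.
  rewrite /g; case: ifP => [/above kr|_]; last by rewrite subr_gt0.
  by rewrite lt_min !subr_gt0 below.
have gk : g <= 1 - psi k alpha_star by rewrite /g; case: ifP; rewrite ?ge_min ?lexx.
have near_above :
    \forall n \near \oo, (k < r)%N -> 1 + g / 2 < psi k.+1 (alpha n).
  case: (ltnP k r) => [kr|_]; last by near=> n.
  have gk1 : g <= psi k.+1 alpha_star - 1 by rewrite /g kr ge_min lexx orbT.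
  near=> n => _; near: n; apply: (cvgr_gt (psi k.+1 alpha_star)); last by lra.
  exact: cvg_psi.
(* In the limit the distances of psi_k and psi_(k+1) to 1 are at least g; they
   are eventually at least g / 2 = 16 (g / 32). *)
exists (g / 32); near=> n; split; first by lra.
  have : psi k (alpha n) < 1 - g / 2.
    near: n; apply: (cvgr_lt (psi k alpha_star)); first exact: cvg_psi.
    by lra.
  lra.
move=> kr; have : 1 + g / 2 < psi k.+1 (alpha n) by move: (kr); near: n.
lra.
Unshelve. all: by end_near. Qed.

Lemma cvg_error_bound h c : 0 < h ->
  (fun n => c * error_bound r n h) @ \oo --> (0 : R).
Proof.
move=> h0; suff : (fun n => c * error_bound r n h) @ \oo --> (c * (2 ^+ r.+1 * 0) : R).
  by rewrite !mulr0.
by do 2!apply: cvgMl_tmp; apply: cvg_natr_powRN; rewrite mulr_gt0.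
Qed.

Lemma cvg_relative_error h : 0 < h ->
  (fun n => relative_error n h k) @ \oo --> (0 : R).
Proof.
move=> h0; suff : (fun n => relative_error n h k) @ \oo -->
   (3 * k.+1`!%:R * 0 + (1 - 1) : R) by rewrite mulr0 subrr addr0.
apply: cvgD; first by apply: cvgMl_tmp; apply: cvg_natr_powRN.
by apply: cvgB; [exact: cvg_cst | exact: cvg_bin_ratio].
Qed.

End Asymptotics.

Theorem theorem7 (R : realType) (r : nat) (alpha : nat -> 'rV[R]_r.+1)
    (alpha_star : 'rV[R]_r.+1) (k : nat)
    (alpha_ge0 : forall n i, 0 <= alpha n 0 i)
    (alpha_lim : alpha @ \oo --> alpha_star)
    (k_le_r : (k <= r)%N)
    (alpha_star_dom : in_domain k alpha_star) :
  [/\ exists2 t : nat -> R, t @ \oo --> (0 : R) &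
        aas alpha (fun n Y =>
          (1 - t n) * (n%:R `^ tau k (alpha n) / (k.+1)`!%:R)
            <= (betti Y k)%:R
            <= (1 + t n) * (n%:R `^ tau k (alpha n) / (k.+1)`!%:R)),
      forall j : nat, j <> k ->
        exists2 t : nat -> R, t @ \oo --> (0 : R) &
          aas alpha (fun n Y =>
            (betti Y j)%:R
              <= (1 + t n) * (r.+1)`!%:R * n%:R `^ (- gap (alpha n))
                 * (betti Y k)%:R)
    & (k < r)%N ->
        \forall n \near \oo,
          gap (alpha n) =
            Num.min (1 - psi k (alpha n)) (psi k.+1 (alpha n) - 1)].
Proof.
have [h crit] := near_critical_margin alpha_lim alpha_star_dom.
have h0 : 0 < h by have [N _ /(_ N (leqnn N)) []] := crit.
have t0 := cvg_relative_error k h0.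
split.
- exists (fun n => relative_error n h k) => //.
  apply: (aas_of_bound alpha_ge0 (cvg_error_bound r 3 h0)); near=> n.
  have n0 : (0 < n)%N by near: n; exact: nbhs_infty_gt.
  by apply: (betti_critical (alpha_ge0 n) n0 k_le_r); near: n.
- move=> j /eqP jDk.
  (* The numerator comes from the bound on b_j and the denominator from the
     lower bound on b_k; the quotient of factorials is at most (r+1)!. *)
  exists (fun n => (1 + n%:R `^ (- h)) / (1 - relative_error n h k) - 1).
    suff : (fun n => (1 + n%:R `^ (- h)) / (1 - relative_error n h k) - 1) @ \oo
        --> ((1 + 0) / (1 - 0) - 1 : R) by rewrite addr0 subr0 divr1 subrr.
    apply: cvgB; last exact: cvg_cst.
    apply: cvgM; first by apply: cvgD; [exact: cvg_cst | exact: cvg_natr_powRN].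
    apply: cvgV; first by rewrite subr0 oner_neq0.
    by apply: cvgB; first exact: cvg_cst.
  (* One exceptional event for b_j and three for b_k. *)
  apply: (aas_of_bound alpha_ge0 (cvg_error_bound r 4 h0)); near=> n.
  have n0 : (0 < n)%N by near: n; exact: nbhs_infty_gt.
  have critn : critical_margin (alpha n) k h by near: n.
  have tlt1 : relative_error n h k < 1.
    by near: n; apply: (cvgr_lt 0).
  have p01 := pvec_bounds (alpha_ge0 n) n0.
  have off := betti_off_critical (alpha_ge0 n) n0 k_le_r critn jDk.
  have at_k := betti_critical (alpha_ge0 n) n0 k_le_r critn.
  set t := relative_error n h k in tlt1 at_k *; set u := n%:R `^ (- h) in off *.
  set A := (fun Y => _ < _) in off; set B := (fun Y => ~~ _) in at_k.
  apply: (@le_trans _ _ (prob_event (pvec n (alpha n)) (fun Y => A Y || B Y))).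
    apply: le_prob_event => // Y _; apply: contraNT; rewrite negb_or negbK.
    move=> /andP[]; rewrite /A -leNgt => bj /andP[bk _].
    have D0 : 0 < 1 - t by rewrite subr_gt0.
    have F0 : 0 < k.+1`!%:R :> R by rewrite ltr0n fact_gt0.
    apply: le_trans bj _; set g := n%:R `^ (- gap (alpha n)).
    rewrite -natr_powRD // -/g.
    have -> : (1 + ((1 + u) / (1 - t) - 1)) * r.+1`!%:R * g * (betti Y k)%:R =
        (1 + u) * (r.+1`!%:R * (betti Y k)%:R / (1 - t) * g).
      by field; rewrite gt_eqF.
    rewrite ler_wpM2l ?addr_ge0 ?powR_ge0 // ler_wpM2r ?powR_ge0 //.
    rewrite ler_pdivlMr //.
    apply: (@le_trans _ _ (k.+1`!%:R * (betti Y k)%:R)).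
      rewrite -ler_pdivrMl //; apply: le_trans bk.
      by rewrite [leLHS]mulrC mulrAC [leLHS]mulrC.
    by rewrite ler_wpM2r // ler_nat leq_fact.
  have := prob_event_or p01 A B; lra.
- move=> kr; near=> n; apply: (gapE (alpha_ge0 n) k_le_r _ kr (h := h)).
  by near: n.
Unshelve. all: by end_near. Qed.
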